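(* Let $(B,+,\circ)$ be a Dedekind skew brace having an ascending series of ideals whose factors are trivial skew braces (this holds in particular when $B$ is hypermultipermutational). If $(Z(B),+)$ is torsion-free, then $B$ is a trivial brace.
   Context: A skew brace is a triple $(B,+,\circ)$ with $(B,+)$, $(B,\circ)$ (not necessarily abelian) groups such that $a\circ(b+c)=a\circ b-a+a\circ c$ for all $a,b,c\in B$. The identities of the two groups coincide and are denoted by $0$. For $a\in B$ put $\lambda_a(b)=-a+a\circ b$; then $\lambda:a\mapsto\lambda_a$ is a homomorphism $(B,\circ)\to\operatorname{Aut}(B,+)$. A sub-skew brace is a subset that is a subgroup of both $(B,+)$ and $(B,\circ)$. An ideal is a subgroup of $(B,+)$ that is normal in $(B,+)$, invariant under all $\lambda_b$, and normal in $(B,\circ)$; one can form the quotient skew brace $B/I$. $B$ is Dedekind if all its sub-skew braces are ideals of $B$. $B$ is trivial (a trivial brace, a ''group'') if $a+b=a\circ b$ for all $a,b\in B$. An ascending series of ideals of $B$ is a chain of ideals $\{0\}=I_0\leq I_1\leq\cdots\leq I_\alpha\leq I_{\alpha+1}\leq\cdots\leq I_\mu=B$ indexed by the ordinals up to some ordinal $\mu$, with unions taken at limit ordinals; its factors are the skew braces $I_{\alpha+1}/I_\alpha$. The socle is $\operatorname{Soc}(B)=\operatorname{Ker}(\lambda)\cap Z(B,+)$ and the centre is $Z(B)=\operatorname{Soc}(B)\cap Z(B,\circ)$. The upper socle series is $\operatorname{Soc}_0(B)=\{0\}$, $\operatorname{Soc}_{\alpha+1}(B)/\operatorname{Soc}_\alpha(B)=\operatorname{Soc}(B/\operatorname{Soc}_\alpha(B))$,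 with unions at limit ordinals; $B$ is hypermultipermutational if $B=\operatorname{Soc}_\alpha(B)$ for some ordinal $\alpha$. *)

(* Defs.v *)
From HB Require Import structures.
From mathcomp Require Import all_boot all_order all_classical.

Set Implicit Arguments.
Unset Strict Implicit.
Unset Printing Implicit Defensive.

Declare Scope brace_scope.
Delimit Scope brace_scope with B.

Local Open Scope classical_set_scope.
Local Open Scope quotient_scope.
Local Open Scope brace_scope.

Notation "x ∘ y" := (mul x y) (at level 40, left associativity) : brace_scope.

(* (B, ∘) is a groupType, with unit 1%g and inverse x^-1%g; (B, +) is given by *)
(* separate operations, since the additive groups of the library (zmodType)    *)
(* are abelian. The two units are provably equal (brace01).                    *)
HB.mixin Record Group_isSkewBrace B of Group B := {
  bradd : B -> B -> B;
  brzero : B;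
  bropp : B -> B;
  braddA : associative bradd;
  bradd0 : left_id brzero bradd;
  braddr0 : right_id brzero bradd;
  braddN : left_inverse brzero bropp bradd;
  braddrN : right_inverse brzero bropp bradd;
  brmulD : forall a b c : B,
    a ∘ bradd b c = bradd (bradd (a ∘ b) (bropp a)) (a ∘ c)
}.

#[short(type="skewBraceType")]
HB.structure Definition SkewBrace := {B of Group_isSkewBrace B & Group B}.

Bind Scope brace_scope with SkewBrace.sort.

Notation "0" := (@brzero _) : brace_scope.
Notation "x + y" := (bradd x y) : brace_scope.
Notation "- x" := (bropp x) : brace_scope.
Notation "x - y" := (bradd x (bropp y)) : brace_scope.

(* The group (B, +), written multiplicatively. *)
Definition addg (B : Type) := B.

HB.instance Definition _ (B : skewBraceType) := Choice.on (addg B).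
HB.instance Definition _ (B : skewBraceType) :=
  isGroup.Build (addg B) (@braddA B) (@bradd0 B) (@braddr0 B)
    (@braddN B) (@braddrN B).

Notation "x *+ n" := (@natexp (addg _) x n) : brace_scope.

Section AdditiveGroup.
Variable B : skewBraceType.

Lemma braddKr : left_loop (@bropp B) (@bradd B).
Proof. exact: (@mulKg (addg B)). Qed.

Lemma braddNKr : rev_left_loop (@bropp B) (@bradd B).
Proof. exact: (@mulVKg (addg B)). Qed.

End AdditiveGroup.

Section SkewBraceNotions.
Variable B : skewBraceType.
Implicit Types (a b : B) (S : set B).

Definition lambda a b : B := - a + a ∘ b.

Definition sub_skew_brace S :=
  @group_closed (addg B) [in S] /\ group_closed [in S].

Record is_ideal S : Prop := IsIdeal {
  ideal_add_subgroup : @group_closed (addg B) [in S];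
  ideal_add_normal : forall a b, S a -> S (b + a - b);
  ideal_lambda : forall a b, S a -> S (lambda b a);
  ideal_mul_subgroup : group_closed [in S];
  ideal_mul_normal : forall a b, S a -> S (b ∘ a ∘ (b^-1)%g)
}.

Record ideal := Ideal { ideal_set :> set B; idealP : is_ideal ideal_set }.

Definition dedekind := forall S, sub_skew_brace S -> is_ideal S.

Definition trivial_brace := forall a b, a + b = a ∘ b.

(* S, with the operations of B restricted to it, is a trivial brace. *)
Definition trivial_on S := forall a b, S a -> S b -> a + b = a ∘ b.

Definition ker_lambda : set B := [set a | lambda a =1 id].
Definition add_center : set B := [set a | forall b, a + b = b + a].
Definition mul_center : set B := [set a | forall b, a ∘ b = b ∘ a].
Definition socle : set B := ker_lambda `&` add_center.
Definition center : set B := socle `&` mul_center.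

Definition add_torsion_free S :=
  forall a n, S a -> (0 < n)%N -> a *+ n = 0 -> a = 0.

Lemma brace01 : 0 = 1%g :> B.
Proof.
have := brmulD 1%g 0 (0 : B); rewrite bradd0 !mul1g bradd0 braddr0 => E.
by rewrite -[RHS]bradd0 [in RHS]E braddN.
Qed.

Lemma lambdaD a : {morph lambda a : b c / b + c}.
Proof. by move=> b c; rewrite /lambda brmulD !braddA. Qed.

Lemma lambda0 a : lambda a 0 = 0.
Proof. by rewrite /lambda brace01 mulg1 braddN brace01. Qed.

Lemma mulVg_lambda a b : (a^-1)%g ∘ b = lambda (a^-1)%g (- a + b).
Proof.
have H : lambda (a^-1)%g a + lambda (a^-1)%g (- a) = 0.
  by rewrite -lambdaD braddrN lambda0.
have {H} : lambda (a^-1)%g (- a) = (a^-1)%g.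
  rewrite {1}/lambda mulVg -brace01 braddr0 in H.
  by rewrite -[LHS](braddNKr (a^-1)%g) H braddr0.
by rewrite lambdaD => ->; rewrite /lambda braddNKr.
Qed.

End SkewBraceNotions.

Arguments ker_lambda B : clear implicits.
Arguments add_center B : clear implicits.
Arguments mul_center B : clear implicits.
Arguments socle B : clear implicits.
Arguments center B : clear implicits.

Section GroupCongruence.
Variables (G : groupType) (S : set G).
Hypothesis SG : group_closed [in S].
Hypothesis SJ : forall a b : G, S a -> S (b * a * b^-1)%g.

Lemma cong_refl (x : G) : S (x^-1 * x)%g.
Proof. by rewrite mulVg; have [/set_mem] := SG. Qed.

Lemma cong_sym (x y : G) : S (x^-1 * y)%g -> S (y^-1 * x)%g.
Proof.
move=> /mem_set h; apply: set_mem.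
by have := group_closedV SG h; rewrite invgM invgK.
Qed.

Lemma cong_trans (x y z : G) :
  S (x^-1 * y)%g -> S (y^-1 * z)%g -> S (x^-1 * z)%g.
Proof.
move=> /mem_set h /mem_set k; apply: set_mem.
by have := group_closedM SG h k; rewrite -mulgA mulVKg.
Qed.

Lemma cong_inv (x y : G) : S (x^-1 * y)%g -> S ((x^-1)^-1 * y^-1)%g.
Proof. by move=> /cong_sym/(SJ x); rewrite invgK mulgA mulgK. Qed.

Lemma cong_mul (x x' y y' : G) :
  S (x^-1 * x')%g -> S (y^-1 * y')%g -> S ((x * y)^-1 * (x' * y'))%g.
Proof.
move=> hx /mem_set hy; apply: set_mem.
have /mem_set := SJ (y^-1)%g hx; rewrite invgK => k.
have := group_closedM SG k hy.
by rewrite invgM -!mulgA mulVKg.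
Qed.

End GroupCongruence.

Section Quotient.
Variables (B : skewBraceType) (I : ideal B).
Implicit Types x y : B.

Definition ideal_equiv x y : bool := (- x + y) \in (I : set B).

Let IG := ideal_mul_subgroup (idealP I).
Let IJ := ideal_mul_normal (idealP I).

Let addIG : @group_closed (addg B) [in (I : set B)].
Proof. exact: ideal_add_subgroup (idealP I). Qed.

Let addIJ (a b : addg B) : (I : set B) a -> (I : set B) (b * a * b^-1)%g.
Proof. exact: (@ideal_add_normal _ _ (idealP I) a b). Qed.

(* Additive and multiplicative cosets of I coincide. *)
Lemma ideal_equiv_mul x y : ideal_equiv x y <-> (I : set B) ((x^-1)%g ∘ y).
Proof.
rewrite /ideal_equiv in_setE; split=> h.
  by rewrite mulVg_lambda; apply: (ideal_lambda (idealP I)).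
by have := ideal_lambda (idealP I) x h; rewrite /lambda mulVKg.
Qed.

Lemma ideal_equiv_is_equiv : equiv_class_of ideal_equiv.
Proof.
split=> [x|x y|y x z]; rewrite /ideal_equiv.
- exact/mem_set/(@cong_refl (addg B) _ addIG x).
- by apply/idP/idP => /set_mem h; apply/mem_set;
     [exact: (@cong_sym (addg B) _ addIG x y)
     |exact: (@cong_sym (addg B) _ addIG y x)].
- move=> /set_mem h /set_mem k; apply/mem_set.
  exact: (@cong_trans (addg B) _ addIG x y z).
Qed.

Canonical ideal_equiv_equiv := EquivRelPack ideal_equiv_is_equiv.
Canonical ideal_equiv_encModRel := defaultEncModRel ideal_equiv.

Definition quot := {eq_quot ideal_equiv}.

HB.instance Definition _ : EqQuotient B ideal_equiv quot := EqQuotient.on quot.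
HB.instance Definition _ := Choice.on quot.

Definition qadd (p q : quot) : quot := \pi_quot (repr p + repr q).
Definition qopp (p : quot) : quot := \pi_quot (- repr p).
Definition qmul (p q : quot) : quot := \pi_quot (repr p ∘ repr q).
Definition qinv (p : quot) : quot := \pi_quot ((repr p)^-1)%g.

Let pi_eq x y : \pi_quot x = \pi_quot y <-> ideal_equiv x y.
Proof.
by split=> [/eqP|h]; [rewrite piE|apply/eqP; rewrite piE].
Qed.

Let repr_equiv x : ideal_equiv (repr (\pi_quot x)) x.
Proof. by apply/pi_eq; rewrite reprK. Qed.

Let repr_equiv_mul x : (I : set B) (((repr (\pi_quot x))^-1)%g ∘ x).
Proof. exact/ideal_equiv_mul/repr_equiv. Qed.

Lemma pi_add : {morph \pi_quot : x y / x + y >-> qadd x y}.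
Proof.
move=> x y; apply/esym/pi_eq/mem_set.
by apply: (@cong_mul (addg B) _ addIG addIJ); apply/set_mem/repr_equiv.
Qed.

Lemma pi_opp : {morph \pi_quot : x / - x >-> qopp x}.
Proof.
move=> x; apply/esym/pi_eq/mem_set.
by apply: (@cong_inv (addg B) _ addIG addIJ); apply/set_mem/repr_equiv.
Qed.

Lemma pi_mul : {morph \pi_quot : x y / x ∘ y >-> qmul x y}.
Proof.
by move=> x y; apply/esym/pi_eq/ideal_equiv_mul/(cong_mul IG IJ).
Qed.

Lemma pi_inv : {morph \pi_quot : x / (x^-1)%g >-> qinv x}.
Proof. by move=> x; apply/esym/pi_eq/ideal_equiv_mul/(cong_inv IG IJ). Qed.

Let qaddA : associative qadd.
Proof.
elim/quotW=> x; elim/quotW=> y; elim/quotW=> z.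
by rewrite -(pi_add y z) -(pi_add x) -(pi_add x y) -(pi_add _ z) braddA.
Qed.

Let qadd0 : left_id (\pi_quot 0) qadd.
Proof. by elim/quotW=> x; rewrite -(pi_add 0) bradd0. Qed.

Let qaddr0 : right_id (\pi_quot 0) qadd.
Proof. by elim/quotW=> x; rewrite -(pi_add x) braddr0. Qed.

Let qaddN : left_inverse (\pi_quot 0) qopp qadd.
Proof. by elim/quotW=> x; rewrite -(pi_opp x) -(pi_add _ x) braddN. Qed.

Let qaddrN : right_inverse (\pi_quot 0) qopp qadd.
Proof. by elim/quotW=> x; rewrite -(pi_opp x) -(pi_add x) braddrN. Qed.

Let qmulA : associative qmul.
Proof.
elim/quotW=> x; elim/quotW=> y; elim/quotW=> z.
by rewrite -(pi_mul y z) -(pi_mul x) -(pi_mul x y) -(pi_mul _ z) mulgA.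
Qed.

Let qmul1 : left_id (\pi_quot 1%g) qmul.
Proof. by elim/quotW=> x; rewrite -(pi_mul 1%g) mul1g. Qed.

Let qmulr1 : right_id (\pi_quot 1%g) qmul.
Proof. by elim/quotW=> x; rewrite -(pi_mul x) mulg1. Qed.

Let qmulV : left_inverse (\pi_quot 1%g) qinv qmul.
Proof. by elim/quotW=> x; rewrite -(pi_inv x) -(pi_mul _ x) mulVg. Qed.

Let qmulrV : right_inverse (\pi_quot 1%g) qinv qmul.
Proof. by elim/quotW=> x; rewrite -(pi_inv x) -(pi_mul x) mulgV. Qed.

Let qmulD p q r : qmul p (qadd q r) = qadd (qadd (qmul p q) (qopp p)) (qmul p r).
Proof.
elim/quotW: p => x; elim/quotW: q => y; elim/quotW: r => z.
rewrite -(pi_add y z) -(pi_mul x) -(pi_mul x y) -(pi_mul x z) -(pi_opp x).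
by rewrite -(pi_add (x ∘ y)) -(pi_add _ (x ∘ z)) brmulD.
Qed.

HB.instance Definition _ := isGroup.Build quot qmulA qmul1 qmulr1 qmulV qmulrV.
HB.instance Definition _ :=
  Group_isSkewBrace.Build quot qaddA qadd0 qaddr0 qaddN qaddrN qmulD.

Lemma pi_braddE x y : \pi_quot (x + y) = \pi_quot x + \pi_quot y.
Proof. exact: pi_add. Qed.

Lemma pi_broppE x : \pi_quot (- x) = - \pi_quot x.
Proof. exact: pi_opp. Qed.

Lemma pi_brmulE x y : \pi_quot (x ∘ y) = \pi_quot x ∘ \pi_quot y.
Proof. exact: pi_mul. Qed.

Lemma pi_brinvE x : \pi_quot (x^-1)%g = ((\pi_quot x)^-1)%g.
Proof. exact: pi_inv. Qed.

Lemma pi_quot_eq x y :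
  \pi_quot x = \pi_quot y <-> (I : set B) (- x + y).
Proof. by split=> [/pi_eq/set_mem|h]; [|exact/pi_eq/mem_set]. Qed.

(* J / I as a subset of the quotient skew brace B / I. *)
Definition factor (J : set B) : set quot := \pi_quot @` J.

End Quotient.

Arguments quot {B} I.
Arguments factor {B} I J.

(* The ordinals up to μ are the elements of a well-founded totally ordered     *)
(* type with least element \bot (the ordinal 0) and greatest element \top (μ). *)
Section Series.
Variables (d : Order.disp_t) (J : tbOrderType d).
Implicit Types i j : J.

Definition succ_of i j := (i < j)%O /\ forall k, (i < k)%O -> (j <= k)%O.

Definition limit_index j := j != \bot%O /\ forall i, ~ succ_of i j.

Variable B : skewBraceType.
Implicit Type I : J -> ideal B.

Record ideal_chain I : Prop := IdealChain {
  chain_wf : well_founded (fun i j => (i < j)%O);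
  chain0 : I \bot%O = [set 0] :> set B;
  chain_le : forall i j, (i <= j)%O -> I i `<=` I j;
  chain_limit : forall j, limit_index j ->
    I j = \bigcup_(i in [set i | (i < j)%O]) I i :> set B
}.

Definition ascending_series I := ideal_chain I /\ I \top%O = [set: B] :> set B.

Definition trivial_factors I :=
  forall i j, succ_of i j -> trivial_on (factor (I i) (I j)).

(* I i = Soc_i(B) for every i; unique by well-founded induction. *)
Definition upper_socle_series I :=
  ideal_chain I /\
  forall i j, succ_of i j -> factor (I i) (I j) = socle (quot (I i)).

End Series.

Definition has_trivial_series (B : skewBraceType) :=
  exists (d : Order.disp_t) (J : tbOrderType d) (I : J -> ideal B),
    ascending_series I /\ trivial_factors I.

Definition hypermultipermutational (B : skewBraceType) :=
  exists (d : Order.disp_t) (J : tbOrderType d) (I : J -> ideal B),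
    upper_socle_series I /\ I \top%O = [set: B] :> set B.

(* Main.v *)
Require Import Defs.
From mathcomp Require Import all_boot all_order all_algebra all_classical.
From mathcomp Require Import ring.

Set Implicit Arguments.
Unset Strict Implicit.
Unset Printing Implicit Defensive.

Local Open Scope classical_set_scope.
Local Open Scope brace_scope.

(** The idea is that B is forced to equal its centre. Write [star x y] for
    -x + x∘y - y, and call [star x x] the self-star of x. If the self-star of x
    is 0, then the subgroups generated by x in (B, +) and in (B, ∘) coincide
    ([acycE]), so this cyclic group is a sub-skew brace and hence an ideal.

    The series is used only through [trivial_series_star_nil]: iterating the
    self-star from any x strictly descends in the series, so it reaches 0 after
    finitely many steps. Unlike the series, this property passes to quotients at
    no cost. By induction on the number of steps it remains to show that x is
    central as soon as its self-star z is ([star_self_central_center]).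

    - First, z = 0 ([star_self_central_eq0]). Otherwise z has infinite order,
      and the sub-skew brace generated by 2x and 4z is an ideal that has to
      contain λ_x(2x) - 2x = 2z, which a parity argument excludes.

    - If x has infinite order, it is enough to see that x is central modulo px
      for every prime p ([infinite_order_center]); if x has finite order, a
      multiple of x of prime order would be a torsion element of the centre. So
      everything rests on [prime_order_center]: an element a of prime order p
      with self-star 0 is central.

    - To prove this, divide by an ideal maximal among those that avoid a, so that
      every nonzero sub-skew brace contains a. Then every element x lies at the
      top of a finite chain of ideals with factors of order p
      ([monolithic_prime_chain]), so x is a p-element of both groups and cannot
      act nontrivially on the ideal of order p generated by a. The chain is built
      along the iterated self-star. If the self-star of x lies in such a chain
      P, some y congruent to a multiple p^j x modulo P has self-star 0
      ([prime_chain_star_lift]); since the cyclic ideal of y contains a when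
      y ≠ 0, its order is a power of p, and the chain extends to x. The lift from
      one factor of order p to the next is the computational heart of the proof,
      [star_zero_lift_prime]. *)

(** * Cyclic subgroups and p-elements *)

Section Groups.
Local Open Scope group_scope.
Variable G : groupType.
Implicit Types (x y : G) (S : set G).

(** The cyclic subgroup generated by [x]; pairs of natural exponents stand for
    an integer exponent. *)
Definition cyc x : set G := [set y | exists m n, y = x ^+ m / x ^+ n].

Lemma mem_cyc x : cyc x x.
Proof. by exists 1%N, 0%N; rewrite expg0 invg1 mulg1. Qed.

Lemma cyc_closed x : group_closed [in cyc x].
Proof.
split=> [|_ _ /set_mem[m [n ->]] /set_mem[k [l ->]]]; apply/mem_set.
  by exists 0%N, 0%N; rewrite mulgV.
have C i j : commute (x ^+ i) (x ^+ j) by apply: commuteX2.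
have D : commute (x ^+ l / x ^+ k) (x ^- n).
  by apply: commuteV; apply/commute_sym/commuteM; last apply: commuteV.
by exists (m + l)%N, (n + k)%N; rewrite invgF !expgnDr invgM -!mulgA -D !mulgA.
Qed.

Lemma group_closedI S : S 1 -> (forall x y, S x -> S y -> S (x / y)) ->
  group_closed [in S].
Proof.
by move=> S1 SV; split=> [|x y /set_mem Sx /set_mem Sy]; apply/mem_set; auto.
Qed.

Lemma group_closed1 S : group_closed [in S] -> S 1.
Proof. by case=> /set_mem. Qed.

Lemma group_closed_div S x y : group_closed [in S] -> S x -> S y -> S (x / y).
Proof. by case=> _ h /mem_set Sx /mem_set Sy; apply/set_mem/h. Qed.

Lemma group_closed_inv S x : group_closed [in S] -> S x -> S x^-1.
Proof.
by move=> gS Sx; rewrite -div1g; apply: group_closed_div => //; apply: group_closed1.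
Qed.

Lemma group_closed_mul S x y : group_closed [in S] -> S x -> S y -> S (x * y).
Proof.
move=> gS Sx Sy; rewrite -[y]invgK; apply: group_closed_div => //.
exact: group_closed_inv.
Qed.

Lemma group_closed_exp S x n : group_closed [in S] -> S x -> S (x ^+ n).
Proof.
move=> gS Sx; elim: n => [|n IH]; first by rewrite expg0; apply: group_closed1.
by rewrite expgS; apply: group_closed_mul.
Qed.

Lemma exp_div_eq x m n k l :
  x ^+ m / x ^+ n = x ^+ k / x ^+ l -> x ^+ (m + l) = x ^+ (k + n).
Proof.
move=> E; rewrite !expgnDr -[x ^+ m](mulgVK (x ^+ n)) E -!mulgA.
by congr (_ * _); rewrite -!expgnDr addnC expgnDr mulKg.
Qed.

Lemma exp_inj x i j : (forall n, (0 < n)%N -> x ^+ n <> 1) ->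
  x ^+ i = x ^+ j -> i = j.
Proof.
move=> x_inf; wlog ij : i j / (i <= j)%N => [IH|xij].
  by move=> xij; have [/IH|/ltnW/IH] := leqP i j => h; [|symmetry]; apply: h.
apply/eqP; rewrite eqn_leq ij -subn_eq0 -leqn0 leqNgt; apply/negP => /x_inf; apply.
by apply: (@mulgI _ (x ^+ i)); rewrite -expgnDr subnKC // mulg1.
Qed.

Lemma exp_mod p x n : x ^+ p = 1 -> x ^+ (n %% p) = x ^+ n.
Proof.
by move=> xp; rewrite [in RHS](divn_eq n p) mulnC expgnDr expgnA xp expg1n mul1g.
Qed.

Lemma exp_modr p x m n : x ^+ p = 1 -> m = n %[mod p] -> x ^+ m = x ^+ n.
Proof. by move=> xp mn; rewrite -(exp_mod m xp) mn exp_mod. Qed.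

Lemma exp_coprime_eq1 x m n : x ^+ m = 1 -> x ^+ n = 1 -> coprime m n -> x = 1.
Proof.
case: m => [|m] xm xn.
  by rewrite /coprime gcd0n => /eqP n1; rewrite -[x]expg1 -n1.
move=> /eqP mn; case: (egcdnP n (ltn0Sn m)) => u v uv _.
have : x ^+ (u * m.+1) = x ^+ (v * n + gcdn m.+1 n) by rewrite uv.
by rewrite mn expgnDr expg1 !(mulnC _ m.+1, mulnC _ n) !expgnA xm xn !expg1n mul1g.
Qed.

Lemma cyc_torsion p x y : (0 < p)%N -> x ^+ p = 1 -> cyc x y ->
  exists n, y = x ^+ n.
Proof.
move=> p0 xp [m [n ->]]; exists (m + (p - 1) * n)%N; rewrite expgnDr.
congr (_ * _); apply: (mulIg (x ^+ n)); rewrite mulVg -expgnDr.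
by rewrite -mulSnr subn1 prednK // expgnA xp expg1n.
Qed.

Lemma cyc_exp p x y : x ^+ p = 1 -> cyc x y -> y ^+ p = 1.
Proof.
move=> xp [m [n ->]]; rewrite expgnFl; last exact: commuteX2.
by rewrite !(expgnAC _ _ p) xp !expg1n mulgV.
Qed.

Lemma cyc_root_torsion p x y : (0 < p)%N -> y ^+ p = 1 -> y <> 1 -> cyc x y ->
  exists2 n, (0 < n)%N & x ^+ n = 1.
Proof.
move=> p0 yp y1 [m [n yE]]; apply: contrapT => x_inf.
have {}x_inf k : (0 < k)%N -> x ^+ k <> 1 by move=> k0 xk; apply: x_inf; exists k.
have : x ^+ (m * p) / x ^+ (n * p) = x ^+ 0 / x ^+ 0.
  by rewrite mulgV !expgnA -expgnFl -?yE //; apply: commuteX2.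
move=> /exp_div_eq/(exp_inj x_inf); rewrite addn0 add0n => /eqP.
rewrite eqn_pmul2r // => /eqP mn.
by apply: y1; rewrite yE mn mulgV.
Qed.

(** A p-element cannot act nontrivially on a group of order p: by Fermat's
    little theorem the multiplier u of the action satisfies u ^ (p ^ n) = u. *)
Lemma iter_endo_fix p n x (f : G -> G) : prime p ->
    {morph f : y z / y * z} -> f 1 = 1 -> x ^+ p = 1 -> cyc x (f x) ->
  iter (p ^ n) f x = x -> f x = x.
Proof.
move=> pp fM f1 xp /(cyc_torsion (prime_gt0 pp) xp)[u fx].
have fX y k : f (y ^+ k) = f y ^+ k.
  by elim: k => [|k IH]; rewrite ?expg0 // !expgS fM IH.
have it k : iter k f x = x ^+ (u ^ k).
  elim: k => [|k IH]; first by rewrite expn0 expg1.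
  by rewrite iterS IH fX fx -expgnA expnS.
rewrite it => h; rewrite fx -[RHS]h; apply: (exp_modr xp).
elim: n {h} => [|n IH]; first by rewrite expn1.
by rewrite expnSr expnM fermat_little.
Qed.

Lemma p_elt_commute p n x y : prime p -> y ^+ p = 1 -> x ^+ (p ^ n) = 1 ->
  cyc y (x * y / x) -> commute x y.
Proof.
move=> pp yp xp yx; pose f z := x * z / x.
have fy : f y = y.
  apply: (@iter_endo_fix p n) => //; rewrite /f.
  - by move=> z t; rewrite !mulgA mulgVK.
  - by rewrite mulg1 mulgV.
  have it m : iter m f y = x ^+ m * y / x ^+ m.
    elim: m => [|m IH] /=; first by rewrite expg0 mul1g invg1 mulg1.
    by rewrite IH /f expgS invgM !mulgA.
  by rewrite it xp mul1g invg1 mulg1.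
by rewrite /commute -{2}fy /f mulgVK.
Qed.
End Groups.

(** * Elements with vanishing self-star *)

Section SkewBraceBasics.
Variable B : skewBraceType.
Implicit Types (a b x y : B) (S : set B).

Definition acyc x : set B := @cyc (addg B) x.

Lemma braddK x y : x + y - y = x.
Proof. exact: (@mulgK (addg B)). Qed.

Lemma braddNK x y : x - y + y = x.
Proof. exact: (@mulgVK (addg B)). Qed.

Lemma braddI x y z : x + y = x + z -> y = z.
Proof. exact: (@mulgI (addg B)). Qed.

Lemma braddIr x y z : y + x = z + x -> y = z.
Proof. exact: (@mulIg (addg B)). Qed.

Lemma brsub0 x y : x - y = 0 -> x = y.
Proof. by move=> h; rewrite -[x](braddNK x y) h bradd0. Qed.

Lemma brmuln1 x : x *+ 1 = x. Proof. by []. Qed.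

Lemma brmulnS x n : x *+ n.+1 = x + x *+ n.
Proof. exact: (@expgS (addg B)). Qed.

Lemma brmulnD x m n : x *+ (m + n) = x *+ m + x *+ n.
Proof. exact: (@expgnDr (addg B)). Qed.

Lemma brmulnA x m n : x *+ (m * n) = x *+ m *+ n.
Proof. exact: (@expgnA (addg B)). Qed.

Lemma br0muln n : 0 *+ n = 0 :> B.
Proof. exact: (@expg1n (addg B)). Qed.

Lemma mulE x y : x ∘ y = x + lambda x y.
Proof. by rewrite /lambda braddNKr. Qed.

Lemma lambda1 y : lambda 0 y = y.
Proof. by rewrite -[LHS]bradd0 -mulE brace01 mul1g. Qed.

Lemma lambdaM x y z : lambda (x ∘ y) z = lambda x (lambda y z).
Proof.
by apply: (@braddI (x ∘ y)); rewrite -mulE -mulgA !mulE -braddA -lambdaD.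
Qed.

Lemma lambdaK x : cancel (lambda x) (lambda (x^-1)%g).
Proof. by move=> y; rewrite -lambdaM mulVg -brace01 lambda1. Qed.

Lemma lambdaMn x y n : lambda x (y *+ n) = lambda x y *+ n.
Proof. by elim: n => [|n IH]; rewrite ?lambda0 // !brmulnS lambdaD IH. Qed.

Lemma lambdaX x n y : lambda (x ^+ n)%g y = iter n (lambda x) y.
Proof.
by elim: n => [|n IH]; rewrite ?expg0 -?brace01 ?lambda1 // expgS lambdaM IH.
Qed.

Lemma lambdaN x y : lambda x (- y) = - lambda x y.
Proof. by apply: (@braddI (lambda x y)); rewrite -lambdaD !braddrN lambda0. Qed.

Definition star x y := - x + x ∘ y - y.

Lemma starE x y : star x y = lambda x y - y. Proof. by []. Qed.

Lemma star0E x y : star x y = 0 <-> lambda x y = y.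
Proof. by split=> [/brsub0//|h]; rewrite starE h braddrN. Qed.

Section SelfStarZero.
Variable x : B.
Hypothesis xx0 : star x x = 0.

Let lxx : lambda x x = x. Proof. exact/star0E. Qed.

Lemma mul_expE n : (x ^+ n)%g = x *+ n.
Proof.
elim: n => [|n IH]; first by rewrite expg0 -brace01.
by rewrite expgS IH mulE lambdaMn lxx brmulnS.
Qed.

Lemma lambda_muln_self m : lambda (x *+ m) x = x.
Proof. by rewrite -mul_expE lambdaX; elim: m => [|m IH] //=; rewrite IH. Qed.

Lemma mul_divE m n : (x ^+ m / x ^+ n)%g = x *+ m - x *+ n.
Proof.
have fix_x k l : lambda (x *+ k) (- (x *+ l)) = - (x *+ l).
  by rewrite lambdaN lambdaMn lambda_muln_self.
have -> : (x ^- n)%g = - (x *+ n).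
  apply: (@mulgI _ (x ^+ n)%g).
  by rewrite mulgV mul_expE mulE fix_x braddrN brace01.
by rewrite mul_expE mulE fix_x.
Qed.

(** On the powers of [x] the two operations agree, so its two cyclic subgroups
    form one sub-skew brace. *)
Lemma acycE : acyc x = cyc x.
Proof. by apply/seteqP; split=> _ [m [n ->]]; exists m, n; rewrite mul_divE. Qed.

Lemma sub_skew_brace_acyc : sub_skew_brace (acyc x).
Proof. by split; [exact: cyc_closed | rewrite acycE; exact: cyc_closed]. Qed.

Lemma star_muln m : star (x *+ m) (x *+ m) = 0.
Proof. by apply/star0E; rewrite lambdaMn lambda_muln_self. Qed.

End SelfStarZero.
End SkewBraceBasics.

(** * Quotients by ideals *)

Local Open Scope quotient_scope.

Section QuotientBraces.
Variables (B : skewBraceType) (I : ideal B).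
Implicit Types (x y : B) (S : set (quot I)).

Lemma pi_eq0 x : \pi_(quot I) x = 0 <-> ideal_set I x.
Proof.
split=> [/esym/pi_quot_eq|Ix].
  by have -> : - 0 + x = x by rewrite -{1}[x]bradd0 braddKr.
by apply/esym/pi_quot_eq; rewrite -{1}[x]bradd0 braddKr.
Qed.

Lemma pi_muln x n : \pi_(quot I) (x *+ n) = (\pi_(quot I) x) *+ n.
Proof. by elim: n => [|n IH] //; rewrite !brmulnS pi_braddE IH. Qed.

Lemma pi_exp x n : \pi_(quot I) (x ^+ n)%g = (\pi_(quot I) x ^+ n)%g.
Proof. by elim: n => [|n IH] //; rewrite !expgS pi_brmulE IH. Qed.

Lemma pi_lambda x y :
  \pi_(quot I) (lambda x y) = lambda (\pi_(quot I) x) (\pi_(quot I) y).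
Proof. by rewrite /lambda pi_braddE pi_brmulE pi_broppE. Qed.

Lemma pi_star x y :
  \pi_(quot I) (star x y) = star (\pi_(quot I) x) (\pi_(quot I) y).
Proof. by rewrite !starE pi_braddE pi_broppE pi_lambda. Qed.

Lemma ideal_starl x y : ideal_set I x -> ideal_set I (star x y).
Proof.
by move=> /pi_eq0 x0; apply/pi_eq0; rewrite pi_star x0 starE lambda1 braddrN.
Qed.

Lemma exp_muln_cong x n :
  ideal_set I (star x x) -> ideal_set I (- (x *+ n) + (x ^+ n)%g).
Proof.
move=> /pi_eq0 xx0; apply/pi_quot_eq.
by rewrite pi_muln pi_exp mul_expE // -pi_star.
Qed.

Lemma sub_skew_brace_preim S :
  sub_skew_brace S -> sub_skew_brace [set x | S (\pi_(quot I) x)].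
Proof.
move=> [aS mS]; split; apply: group_closedI => /=.
- exact: (group_closed1 aS).
- move=> x y Sx Sy; rewrite -[(_ / _)%g]/(x - y) pi_braddE pi_broppE.
  exact: (group_closed_div aS).
- exact: (group_closed1 mS).
- by move=> x y Sx Sy; rewrite pi_brmulE pi_brinvE; apply: (group_closed_div mS).
Qed.

Lemma quot_pi (p : quot I) : exists x, p = \pi_(quot I) x.
Proof. by exists (repr p); rewrite reprK. Qed.

Lemma dedekind_quot : dedekind B -> dedekind (quot I).
Proof.
move=> dedB S sS; have [aJ J_addN J_lam mJ J_mulN] := dedB _ (sub_skew_brace_preim sS).
split; [exact: sS.1 | | | exact: sS.2 |]; move=> p q; have [x ->] := quot_pi p;
  have [y ->] := quot_pi q => Sx.
- by have := J_addN x y Sx; rewrite /= !pi_braddE pi_broppE.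
- by have := J_lam x y Sx; rewrite /= pi_lambda.
- by have := J_mulN x y Sx; rewrite /= !pi_brmulE pi_brinvE.
Qed.

(** The subgroup of (B, +) generated by [I] and [b]. *)
Definition adjoin b : set B := [set x | acyc (\pi_(quot I) b) (\pi_(quot I) x)].

Lemma is_ideal_adjoin b :
  dedekind B -> ideal_set I (star b b) -> is_ideal (adjoin b).
Proof.
move=> dedB Ibb; apply/dedB/sub_skew_brace_preim/sub_skew_brace_acyc.
by rewrite -pi_star; apply/pi_eq0.
Qed.

Lemma mem_adjoin b : adjoin b b. Proof. exact: mem_cyc. Qed.

Lemma sub_adjoin b : I `<=` adjoin b.
Proof.
by move=> x /pi_eq0; rewrite /adjoin /= => ->; 
  exact: (group_closed1 (@cyc_closed (addg (quot I)) _)).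
Qed.

End QuotientBraces.

(** * Killing a self-star of prime order *)

Section PrimeOrderIdeal.
Variables (B : skewBraceType) (p : nat) (b : B).
Hypotheses (p_pr : prime p) (bb0 : star b b = 0) (pb0 : b *+ p = 0).
Hypotheses (b_neq0 : b <> 0) (Ib : is_ideal (acyc b)).

(** Multiples of [b] with coefficients in the field with p elements, so that the
    actions on them become scalar multiplications. *)
Let sc (k : 'F_p) : B := b *+ (k : nat).

Let sc_nat n : b *+ n = sc (n%:R)%R.
Proof.
rewrite /sc val_Fp_nat ?prime_gt1 //.
by symmetry; apply: (@exp_mod (addg B)).
Qed.

Let sc_valE (k : 'F_p) : ((k : nat)%:R)%R = k. Proof. exact: natr_Zp. Qed.

Let scD k l : sc (k + l)%R = sc k + sc l.
Proof. by rewrite -[RHS]brmulnD sc_nat GRing.natrD !sc_valE. Qed.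

Let sc0 : sc 0%R = 0. Proof. by []. Qed.

Let sc1 : sc 1%R = b. Proof. by rewrite -[RHS]brmuln1 sc_nat. Qed.

Let acyc_sc e : acyc b e -> exists k, e = sc k.
Proof.
move=> /(@cyc_torsion (addg B) _ _ _ (prime_gt0 p_pr) pb0) [n ->].
by exists (n%:R)%R; rewrite -sc_nat.
Qed.

Let sc_inj : injective sc.
Proof.
move=> k l kl; apply/eqP; rewrite -GRing.subr_eq0; apply/negPn/negP => d0.
apply/b_neq0/(@exp_coprime_eq1 (addg B) _ (k - l)%R p) => //.
- apply: (@braddIr _ (sc l)); rewrite [LHS](_ : _ = sc (k - l)%R + sc l) //.
  by rewrite -scD GRing.subrK kl [RHS]bradd0.
- rewrite coprime_sym -unitFpE // sc_valE.
  by rewrite GRing.unitfE.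
Qed.

Let endo_sc (f : B -> B) u k :
  {morph f : y z / y + z} -> f b = sc u -> f (sc k) = sc (u * k)%R.
Proof.
move=> fD fb; have f0 : f 0 = 0 by apply: (@braddI _ (f 0)); rewrite -fD !braddr0.
suff fn n : f (b *+ n) = sc (u * n%:R)%R by rewrite [LHS]fn sc_valE.
elim: n => [|n IH]; first by rewrite f0 GRing.mulr0.
by rewrite brmulnS fD IH fb -scD -GRing.natr1 GRing.mulrDr GRing.mulr1 GRing.addrC.
Qed.

Let lambda_sc k l : lambda (sc k) (sc l) = sc l.
Proof. by rewrite [LHS]lambdaMn lambda_muln_self. Qed.

(** The maps λ_x, y ↦ x + y - x and y ↦ x∘y∘x⁻¹ act on the line generated by [b]
    as scalars u, v and w; moreover λ_x(x) = sb + x and λ_b(x) = tb + x. Computing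
    x∘b and λ_(x∘b)(x) in two ways gives vu = w + tw and ut = tw. The element
    x∘kb has self-star 0 exactly when s = u(v - uv - t)k. If this cannot be solved
    for k, the two relations force u = 1 or vu = 1. In the first case λ_x is
    unipotent on the span of [b] and [x], hence of order dividing p there, and the
    p-th power of [x] has self-star 0. In the second case the same holds with λ_x
    replaced by y ↦ x∘y - x, its counterpart in the opposite skew brace. *)
Lemma star_zero_lift_prime x : acyc b (star x x) ->
  exists j y, acyc b (- (x *+ (p ^ j)) + y) /\ star y y = 0.
Proof.
move=> Ixx; have [s] := acyc_sc Ixx; rewrite starE => Hs.
have {}Hs : lambda x x = sc s + x by rewrite -Hs braddNK.
have [u Hu] : exists u, lambda x b = sc u.
  exact/acyc_sc/(ideal_lambda Ib)/mem_cyc.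
have [v Hv] : exists v, x + b - x = sc v.
  exact/acyc_sc/(ideal_add_normal Ib)/mem_cyc.
have [w Hw] : exists w, x ∘ b = sc w ∘ x.
  have /acyc_sc[w wE] := ideal_mul_normal Ib x (@mem_cyc (addg B) b).
  by exists w; rewrite -wE mulgVK.
have [t Ht] : exists t, lambda b x = sc t + x.
  suff /acyc_sc[t tE] : acyc b (star b x) by exists t; rewrite -tE starE braddNK.
  exact/(@ideal_starl _ (Ideal Ib))/mem_cyc.
have lx_sc k : lambda x (sc k) = sc (u * k)%R by apply/endo_sc => //; apply: lambdaD.
have addC k : x + sc k = sc (v * k)%R + x.
  have fD : {morph (fun z => x + z - x) : y z / y + z}.
    by move=> y z; rewrite !braddA braddNK.
  by rewrite -(endo_sc k fD Hv) braddNK.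
have l_sc k : lambda (sc k) x = sc (t * k)%R + x.
  rewrite -[in LHS](sc_valE k) -sc_nat -(mul_expE bb0) lambdaX -[k in RHS]sc_valE.
  elim: (k : nat) => [|n IH]; first by rewrite GRing.mulr0 bradd0.
  rewrite iterS IH lambdaD -{1}sc1 lambda_sc Ht braddA -scD.
  by rewrite -GRing.natr1 GRing.mulrDr GRing.mulr1.
have E1 : (v * u = w + t * w)%R.
  apply/sc_inj/(@braddIr _ x).
  by rewrite -addC -Hu -mulE Hw mulE l_sc braddA scD.
have E2 : (u * t = t * w)%R.
  apply/sc_inj/(@braddIr _ (sc s + x)).
  rewrite -{1}Hs -lx_sc -lambdaD -Ht -lambdaM Hw lambdaM Hs lambdaD lambda_sc.
  by rewrite l_sc !braddA -!scD GRing.addrC.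
have shift_fix (f : B -> B) r : {morph f : y z / y + z} -> f b = b ->
    f x = sc r + x -> iter p f (x ^+ p)%g = (x ^+ p)%g.
  move=> fD fb fx; have fsc k : f (sc k) = sc k.
    by rewrite (@endo_sc f 1%R) ?sc1 // GRing.mul1r.
  have [k Ek] := acyc_sc (@exp_muln_cong _ (Ideal Ib) x p Ixx).
  have -> : (x ^+ p)%g = x *+ p + sc k by rewrite -Ek braddNKr.
  have itD n : {morph iter n f : y z / y + z}.
    by move=> y z; elim: n => [|n IH] //=; rewrite IH fD.
  have itsc n : iter n f (sc k) = sc k by elim: n => [|n IH] //=; rewrite IH.
  have itx n : iter n f x = sc (n%:R * r)%R + x.
    elim: n => [|n IH] /=; first by rewrite GRing.mul0r bradd0.
    rewrite IH fD fsc fx braddA -scD.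
    by rewrite -GRing.natr1 GRing.mulrDl GRing.mul1r.
  have {}itx : iter p f x = x.
    by rewrite itx (GRing.pcharf0 (pchar_Fp p_pr)) GRing.mul0r bradd0.
  rewrite itD itsc; congr (_ + _); elim: (X in x *+ X) => [|n IH].
    by apply: (@braddI _ (iter p f 0)); rewrite -itD !braddr0.
  by rewrite brmulnS itD itx IH.
have cong1 : acyc b (- (x *+ (p ^ 1)) + (x ^+ p)%g).
  by rewrite expn1; apply: (@exp_muln_cong _ (Ideal Ib)).
(* λ_x fixes b. *)
have [u1|u_neq1] := eqVneq u 1%R.
  exists 1%N, (x ^+ p)%g; split=> //; apply/star0E.
  rewrite lambdaX; apply: (shift_fix _ s) => //; first exact: lambdaD.
  by rewrite Hu u1 sc1.
(* y ↦ x∘y - x fixes b. *)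
have [vu1|vu_neq1] := eqVneq (v * u)%R 1%R.
  exists 1%N, (x ^+ p)%g; split=> //; apply/star0E.
  pose g z := x ∘ z - x.
  have gX n z : (x ^+ n)%g ∘ z = iter n g z + (x ^+ n)%g.
    elim: n => [|n IH] /=; first by rewrite expg0 mul1g -brace01 braddr0.
    by rewrite expgS -mulgA IH brmulD /g.
  apply: (@braddI _ (x ^+ p)%g); rewrite -mulE gX (shift_fix _ (v * s)%R) //.
  - by move=> y z; rewrite /g brmulD !braddA.
  - by rewrite /g mulE Hu addC braddK vu1 sc1.
  - by rewrite /g mulE Hs braddA addC braddK.
have u_neq0 : (u != 0)%R.
  apply/eqP => u0; apply: b_neq0.
  by rewrite -[LHS](lambdaK x) Hu u0 sc0 lambda0.
have v_neq0 : (v != 0)%R.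
  apply/eqP => v0; apply: b_neq0.
  by rewrite -[LHS](braddKr x) -[x + b](braddNK _ x) Hv v0 sc0 bradd0 braddN.
have d_neq0 : (u * (v - u * v - t) != 0)%R.
  rewrite GRing.mulf_neq0 // GRing.subr_eq0; apply/eqP => tE.
  have t_neq0 : (t != 0)%R.
    rewrite -tE -{1}[v]GRing.mul1r -GRing.mulrBl GRing.mulf_neq0 //.
    by rewrite GRing.subr_eq0 eq_sym.
  have uw : u = w by apply: (GRing.mulfI t_neq0); rewrite -E2 GRing.mulrC.
  case/eqP: vu_neq1; have /(GRing.mulIf u_neq0) vE : (v * u = (1 + t) * u)%R.
    by rewrite E1 uw; ring.
  have -> : (v * u = v - (v - u * v))%R by ring.
  by rewrite tE vE; ring.
pose k := (s / (u * (v - u * v - t)))%R.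
have yE : x ∘ sc k = sc (v * (u * k))%R + x by rewrite mulE lx_sc addC.
exists 0%N, (x ∘ sc k); split.
  rewrite expn0 brmuln1 mulE braddKr lx_sc.
  by apply: (@group_closed_exp (addg B)); [exact: cyc_closed|exact: mem_cyc].
apply/star0E; rewrite lambdaM yE lambdaD lambda_sc l_sc !lambdaD !lx_sc Hs.
rewrite !braddA -!scD; congr (sc _ + x).
have -> : s = (k * (u * (v - u * v - t)))%R by rewrite GRing.divfK.
by ring.
Qed.

End PrimeOrderIdeal.

(** * Chains of ideals with factors of order p *)

Section PrimePowerChains.
Variables (B : skewBraceType) (p : nat).
Hypotheses (dedB : dedekind B) (p_pr : prime p).
Implicit Types (x y : B) (P : ideal B).

(** [prime_chain P]: a finite chain of ideals leads from 0 to [P], each obtained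
    from the previous one by adjoining an element whose class has self-star 0 and
    order dividing p. *)
Inductive prime_chain : ideal B -> Prop :=
| PrimeChain0 P : ideal_set P = [set 0] -> prime_chain P
| PrimeChainS P Q b : prime_chain P ->
    ideal_set P (star b b) -> ideal_set P (b *+ p) ->
    ideal_set Q = adjoin P b -> prime_chain Q.

Lemma prime_chain_torsion P x : prime_chain P -> ideal_set P x ->
  exists n, x *+ (p ^ n) = 0 /\ (x ^+ (p ^ n))%g = 0.
Proof.
move=> cP; elim: cP x => {P} [P P0 x|P Q b cP IH Pbb Ppb QE x].
  by rewrite P0 => /= ->; exists 0%N; rewrite expn0.
rewrite QE => Qx.
have bb0 : star (\pi_(quot P) b) (\pi_(quot P) b) = 0.
  by rewrite -pi_star; apply/pi_eq0.
have pb0 : (\pi_(quot P) b) *+ p = 0 by rewrite -pi_muln; apply/pi_eq0.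
have [k xE] := @cyc_torsion (addg (quot P)) _ _ _ (prime_gt0 p_pr) pb0 Qx.
have Ppx : ideal_set P (x *+ p).
  by apply/pi_eq0; rewrite pi_muln; apply: (@cyc_exp (addg (quot P)) _ _ _ pb0 Qx).
have Pxp : ideal_set P (x ^+ p)%g.
  apply/pi_eq0; rewrite pi_exp mul_expE; first by rewrite -pi_muln; apply/pi_eq0.
  by rewrite xE; apply: star_muln.
have [n [n1 _]] := IH _ Ppx; have [m [_ m1]] := IH _ Pxp.
exists (maxn n m).+1; rewrite expnS brmulnA expgnA.
have dv i j : (p ^ maxn i j = p ^ i * p ^ (j - i))%N.
  by rewrite -expnD -maxnE.
rewrite {1}dv brmulnA n1 br0muln maxnC dv expgnA m1 brace01 expg1n.
by [].
Qed.

(** Going down the chain, each step moves the self-star one ideal lower by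
    [star_zero_lift_prime], at the price of multiplying [x] by a power of [p]. *)
Lemma prime_chain_star_lift P x : prime_chain P -> ideal_set P (star x x) ->
  exists j y, ideal_set P (- (x *+ (p ^ j)) + y) /\ star y y = 0.
Proof.
move=> cP; elim: cP x => {P} [P P0 x|P Q b cP IH Pbb Ppb QE x Qxx].
  rewrite P0 /= => xx0; exists 0%N, x; split => //.
  by rewrite expn0 brmuln1 braddN.
have PQ : P `<=` Q by rewrite QE; apply: sub_adjoin.
have [j [y [Qy Pyy]]] : exists j y,
    ideal_set Q (- (x *+ (p ^ j)) + y) /\ ideal_set P (star y y).
  have [Pb|Pb] := pselect (ideal_set P b).
    exists 0%N, x; rewrite expn0 brmuln1 braddN; split.
      exact: (group_closed1 (ideal_add_subgroup (idealP Q))).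
    move: Qxx; rewrite QE /adjoin /= => -[m [n]].
    have -> : \pi_(quot P) b = 0 by apply/pi_eq0.
    move=> /= E; apply/pi_eq0; rewrite E.
    by rewrite !(@expg1n (addg (quot P))) (@mulgV (addg (quot P))).
  have aI : is_ideal (acyc (\pi_(quot P) b)).
    apply: (dedekind_quot dedB); apply: sub_skew_brace_acyc.
    by rewrite -pi_star; apply/pi_eq0.
  have [||||j [y' []]] := @star_zero_lift_prime _ p (\pi_(quot P) b) p_pr _ _ _ aI
    (\pi_(quot P) x).
  - by rewrite -pi_star; apply/pi_eq0.
  - by rewrite -pi_muln; apply/pi_eq0.
  - by move=> /pi_eq0.
  - by rewrite -pi_star; move: Qxx; rewrite QE.
  have [y ->] := quot_pi y'; rewrite -pi_star -pi_muln -pi_broppE -pi_braddE.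
  by move=> Qy /pi_eq0 Pyy; exists j, y; rewrite QE.
have [j' [z [Pz zz0]]] := IH y Pyy.
exists (j + j')%N, z; split=> //.
apply/pi_quot_eq; rewrite expnD brmulnA pi_muln.
have /pi_quot_eq -> : ideal_set Q (- (x *+ (p ^ j)) + y) by [].
by rewrite -pi_muln; apply/pi_quot_eq/PQ.
Qed.

(** The chain is prolonged by adjoining p^(k-1) x, ..., p x and x in turn. *)
Lemma prime_chain_root P x k : prime_chain P -> ideal_set P (star x x) ->
  ideal_set P (x *+ (p ^ k)) -> exists2 Q, prime_chain Q & ideal_set Q x.
Proof.
elim: k P => [|k IH] P cP Pxx Px; first by exists P => //; rewrite expn0 in Px.
pose b := x *+ (p ^ k).
have Pbb : ideal_set P (star b b).
  apply/pi_eq0; rewrite pi_star pi_muln; apply: star_muln.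
  by rewrite -pi_star; apply/pi_eq0.
pose Q := Ideal (is_ideal_adjoin dedB Pbb).
apply: (IH Q); last exact: mem_adjoin.
  by apply: (@PrimeChainS P Q b) => //; rewrite -brmulnA -expnSr.
exact: sub_adjoin.
Qed.

(** By induction the self-star of [x] lies in a chain [P]; take y congruent to
    p^j x modulo [P] with self-star 0. If y ≠ 0, the cyclic ideal of y contains
    [a], so y has finite order; the multiple p^f y whose order is prime to p
    must be 0, for otherwise the ideal it generates would contain [a]. Hence p^(j+f) x
    lies in [P], and the chain can be prolonged up to [x]. *)
Lemma monolithic_prime_chain a x :
    a <> 0 -> a *+ p = 0 ->
    (forall S, sub_skew_brace S -> forall y, S y -> y <> 0 -> S a) ->
    (exists n, iter n (fun x => star x x) x = 0) ->
  exists2 P, prime_chain P & ideal_set P x.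
Proof.
move=> a0 pa0 mono [n]; elim: n x => [|n IH] x.
  have I0 : is_ideal [set (0 : B)].
    apply: dedB; split; apply: group_closedI => //.
  - by move=> y z /= -> ->; rewrite (@mulgV (addg B)).
  - by rewrite /= -brace01.
  - by move=> y z /= -> ->; rewrite mulgV -brace01.
  by move=> /= ->; exists (Ideal I0) => //; apply: PrimeChain0.
rewrite iterSr => /IH[P cP Pxx].
have [j [y [Py yy0]]] := prime_chain_star_lift cP Pxx.
suff [f yf] : exists f, y *+ (p ^ f) = 0.
  apply: (@prime_chain_root P x (j + f) cP Pxx).
  apply/pi_eq0; rewrite expnD brmulnA pi_muln.
  have /pi_quot_eq -> : ideal_set P (- (x *+ (p ^ j)) + y) by [].
  by rewrite -pi_muln yf.
have [->|y0] := pselect (y = 0); first by exists 0%N; rewrite br0muln.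
have ya := mono _ (sub_skew_brace_acyc yy0) _ (@mem_cyc (addg B) y) y0.
have [N N0 yN] := @cyc_root_torsion (addg B) _ _ _ (prime_gt0 p_pr) pa0 a0 ya.
exists (logn p N); apply: contrapT => z0.
have /(_ p_pr N0)[M pM NE] := @pfactor_coprime p N.
apply: a0; apply: (@exp_coprime_eq1 (addg B) _ p M) => //.
have za := mono _ (sub_skew_brace_acyc (star_muln yy0 (p ^ logn p N))) _
  (@mem_cyc (addg B) _) z0.
apply: (@cyc_exp (addg B) _ _ _ _ za).
by rewrite -[LHS](@expgnA (addg B)) mulnC -NE.
Qed.

End PrimePowerChains.

(** * Elements of prime order with vanishing self-star *)

Section Centrality.
Implicit Types (B : skewBraceType) (p : nat).

(** The consequence of a series with trivial factors on which the proof is built;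
    see [trivial_series_star_nil]. *)
Definition star_nil B := forall x : B, exists n, iter n (fun y => star y y) x = 0.

Lemma centerI B (a : B) :
  (forall x, [/\ lambda x a = a, x + a = a + x & x ∘ a = a ∘ x]) -> center B a.
Proof.
move=> h; split=> [|x]; last by have [_ _ ->] := h x.
split=> x; have [lx ax mx] := h x; last by rewrite ax.
by rewrite /lambda -mx mulE lx ax braddKr.
Qed.

Lemma center_lambda B (a x : B) : center B a -> lambda x a = a.
Proof.
move=> [[la aa] ma]; apply: (@braddI _ x); rewrite -mulE -ma mulE la.
exact: aa.
Qed.

Lemma center0 B : center B 0.
Proof.
apply: centerI => x; split; first exact: lambda0.
  by rewrite bradd0 braddr0.
by rewrite brace01 mulg1 mul1g.
Qed.

Lemma star_nil_quot B (I : ideal B) : star_nil B -> star_nil (quot I).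
Proof.
move=> nilB q; have [x ->] := quot_pi q; have [n xn] := nilB x; exists n.
have <- : \pi_(quot I) (iter n (fun y => star y y) x) =
    iter n (fun y => star y y) (\pi_(quot I) x).
  by elim: n {xn} => [|n IH] //=; rewrite pi_star IH.
by rewrite xn.
Qed.

(** Every [x] is a p-element of both groups, whereas the three actions of [x] on
    the ideal of order p generated by [a] have order prime to p. *)
Lemma monolithic_center B p (a : B) :
    dedekind B -> star_nil B -> prime p ->
    a <> 0 -> a *+ p = 0 -> star a a = 0 ->
    (forall S, sub_skew_brace S -> forall y, S y -> y <> 0 -> S a) ->
  center B a.
Proof.
move=> dedB nilB pp a0 pa0 aa0 mono; apply: centerI => x.
have [P cP Px] := monolithic_prime_chain dedB pp a0 pa0 mono (nilB x).
have [n [xn xn']] := prime_chain_torsion pp cP Px.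
have Ia := dedB _ (sub_skew_brace_acyc aa0).
have aIa : acyc a a := @mem_cyc (addg B) a.
split.
- apply: (@iter_endo_fix (addg B) p n) => //.
  + exact: lambdaD.
  + exact: lambda0.
  + exact: (ideal_lambda Ia).
  + by rewrite -lambdaX xn' lambda1.
- apply: (@p_elt_commute (addg B) p n) => //.
  exact: (ideal_add_normal Ia).
- apply: (@p_elt_commute B p n) => //.
  + by rewrite mul_expE // pa0 brace01.
  + by rewrite xn' brace01.
  by rewrite -acycE //; apply: (ideal_mul_normal Ia).
Qed.

(** Zorn's lemma, applied to the sets that avoid [a] and become a sub-skew brace
    on adding 0; adding 0 takes care of the empty chain. *)
Lemma maximal_sub_skew_brace_avoiding B (a : B) : a <> 0 ->
  exists N : set B, [/\ sub_skew_brace N, ~ N a &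
    forall S, sub_skew_brace S -> N `<=` S -> ~ S a -> S `<=` N].
Proof.
move=> a0; pose avoids S := sub_skew_brace (S `|` [set 0]) /\ ~ S a.
have [N [[sN Na] maxN]] : exists N, avoids N /\ forall S, N `<` S -> ~ avoids S.
  apply: Zorn_bigcup => F Fav Ftot; split; last by case=> S /Fav[].
  have U0 : (\bigcup_(X in F) X `|` [set 0]) (0 : B) by right.
  have U (X : set B) x : F X -> (X `|` [set 0]) x ->
      (\bigcup_(X in F) X `|` [set 0]) x.
    by move=> FX [Xx|->]; [left; exists X|].
  have UU x y : (\bigcup_(X in F) X `|` [set 0]) x ->
      (\bigcup_(X in F) X `|` [set 0]) y ->
      (x = 0 /\ y = 0) \/
      exists X, [/\ F X, (X `|` [set 0]) x & (X `|` [set 0]) y].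
    move=> [[X FX Xx]|->] [[Y FY Yy]|->].
    - have [XY|YX] := Ftot X Y FX FY; right.
        by exists Y; split=> //; left => //; apply: XY.
      by exists X; split=> //; left => //; apply: YX.
    - by right; exists X; split=> //; [left|right].
    - by right; exists Y; split=> //; [right|left].
    - by left.
  split; apply: group_closedI => //.
  + move=> x y /UU h /h[[-> ->]|[X [FX Xx Xy]]].
      by rewrite (@mulgV (addg B)).
    by apply: (U X) => //; apply: (group_closed_div (proj1 (Fav _ FX)).1).
  + by rewrite -brace01.
  + move=> x y /UU h /h[[-> ->]|[X [FX Xx Xy]]].
      by rewrite mulgV -brace01.
    by apply: (U X) => //; apply: (group_closed_div (proj1 (Fav _ FX)).2).
exists (N `|` [set 0]); split=> // [[]//|S sS NS Sa x Sx].
left; apply: contrapT => Nx; apply: (maxN S).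
  by split=> [y Ny|/(_ x Sx)//]; apply: NS; left.
by split=> //; rewrite setUidl // => _ ->; apply: (group_closed1 sS.1).
Qed.

(** Modulo an ideal [I] maximal among those avoiding [a], the class of [a] is
    central. The ideal generated by [a] has prime order and meets [I] trivially,
    so it embeds in the quotient, and [a] itself is central. *)
Lemma prime_order_center B p (a : B) :
    dedekind B -> star_nil B -> prime p ->
    a *+ p = 0 -> star a a = 0 -> center B a.
Proof.
move=> dedB nilB pp pa0 aa0.
have [->|a0] := pselect (a = 0); first exact: center0.
have [N [sN Na maxN]] := maximal_sub_skew_brace_avoiding a0.
pose I := Ideal (dedB _ sN).
have Ia : ~ ideal_set I a by [].
have cI : center (quot I) (\pi_(quot I) a).
  apply: (@monolithic_center _ p) => //.
  - exact: dedekind_quot.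
  - exact: star_nil_quot.
  - by move=> /pi_eq0.
  - by rewrite -pi_muln pa0.
  - by rewrite -pi_star aa0.
  move=> S sS q; have [y ->] := quot_pi q => Sy /pi_eq0 Iy.
  apply: contrapT => Sa; apply: Iy.
  apply: (maxN [set x | S (\pi_(quot I) x)]) => //.
    exact: sub_skew_brace_preim.
  move=> x Nx /=; have -> : \pi_(quot I) x = 0 by apply/pi_eq0.
  exact: (group_closed1 sS.1).
have aI0 e : acyc a e -> ideal_set I e -> e = 0.
  move=> /(@cyc_torsion (addg B) _ _ _ (prime_gt0 pp) pa0)[k ->] Iak.
  have [/dvdnP[c ->]|pk] := boolP (p %| k)%N.
    by rewrite mulnC (@expgnA (addg B)) pa0; apply: br0muln.
  case: Ia; apply/pi_eq0.
  apply: (@exp_coprime_eq1 (addg (quot I)) _ p k); last by rewrite prime_coprime.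
    by rewrite -[LHS]/(_ *+ _) -pi_muln pa0.
  by rewrite -[LHS]/(_ *+ _) -pi_muln; apply/pi_eq0.
have Ja := dedB _ (sub_skew_brace_acyc aa0).
have aJa : acyc a a := @mem_cyc (addg B) a.
pose J := Ideal Ja.
have key e : ideal_set J e -> \pi_(quot I) e = \pi_(quot I) a -> e = a.
  move=> Je /esym/pi_quot_eq Iae; apply: (@braddI _ (- a)); rewrite braddN.
  apply: aI0 => //; apply: (group_closed_mul (ideal_add_subgroup Ja)) => //.
  exact: (group_closed_inv (ideal_add_subgroup Ja)).
apply: centerI => x; split.
- apply: key; first exact: (ideal_lambda Ja).
  by rewrite pi_lambda center_lambda.
- apply: (@braddIr _ (- x)); rewrite braddK.
  apply: key; first exact: (ideal_add_normal Ja).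
  by rewrite !pi_braddE pi_broppE -cI.1.2 braddK.
- apply: (@mulIg _ (x^-1)%g); rewrite mulgK.
  apply: key; first exact: (ideal_mul_normal Ja).
  by rewrite !pi_brmulE pi_brinvE -cI.2 mulgK.
Qed.

End Centrality.

(** * The torsion-free case *)

Section Conclusion.
Variable B : skewBraceType.
Hypotheses (dedB : dedekind B) (nilB : star_nil B).
Implicit Types (a x : B).

(** For each prime p the class of [a] is central modulo the ideal generated by
    pa, and these ideals intersect in 0. *)
Lemma infinite_order_center a : star a a = 0 ->
  (forall n, (0 < n)%N -> a *+ n <> 0) -> center B a.
Proof.
move=> aa0 a_inf.
pose J p := Ideal (dedB (sub_skew_brace_acyc (star_muln aa0 p))).
have J0 e : (forall p, prime p -> ideal_set (J p) e) -> e = 0.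
  move=> Je; have [m [n eE]] := Je 2%N isT.
  (* A prime exceeding both coefficients of a in e. *)
  have [p mn_p pp] := prime_above (2 * m + 2 * n).
  have [k [l]] := Je p pp; rewrite eE -!(@expgnA (addg B)).
  move=> /(@exp_div_eq (addg B))/(@exp_inj (addg B) _ _ _ a_inf) E.
  have : (2 * m = 2 * n %[mod p])%N.
    by rewrite -(modnMDl l) -(modnMDl k (2 * n)) !(mulnC _ p) addnC E.
  rewrite !modn_small; last 2 first.
  - by apply: leq_ltn_trans mn_p; apply: leq_addl.
  - by apply: leq_ltn_trans mn_p; apply: leq_addr.
  by move=> ->; apply: (@mulgV (addg B)).
have aJ p : prime p -> center (quot (J p)) (\pi_(quot (J p)) a).
  move=> pp; apply: (@prime_order_center _ p) => //.
  - exact: dedekind_quot.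
  - exact: star_nil_quot.
  - by rewrite -pi_muln; apply/pi_eq0/mem_cyc.
  - by rewrite -pi_star aa0.
have key e : (forall p, prime p -> \pi_(quot (J p)) e = \pi_(quot (J p)) a) -> e = a.
  move=> h; apply: (@braddI _ (- a)); rewrite braddN; apply: J0 => p pp.
  exact/pi_quot_eq/esym/h.
apply: centerI => x; split.
- by apply: key => p pp; rewrite pi_lambda (center_lambda _ (aJ p pp)).
- apply: (@braddIr _ (- x)); rewrite braddK; apply: key => p pp.
  by rewrite !pi_braddE pi_broppE -(aJ p pp).1.2 braddK.
- apply: (@mulIg _ (x^-1)%g); rewrite mulgK; apply: key => p pp.
  by rewrite !pi_brmulE pi_brinvE -(aJ p pp).2 mulgK.
Qed.

Hypothesis Z_tf : add_torsion_free (center B).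

Lemma finite_order_eq0 n a : star a a = 0 -> (0 < n)%N -> a *+ n = 0 -> a = 0.
Proof.
elim/ltn_ind: n a => n IH a aa0 n0 na0.
have [n1|n_neq1] := eqVneq n 1%N; first by rewrite -[a]brmuln1 -n1.
have n_gt1 : (1 < n)%N by rewrite ltn_neqAle eq_sym n_neq1.
have pp := pdiv_prime n_gt1; have pn := pdiv_dvd n.
have pa0 : a *+ (n %/ pdiv n) *+ pdiv n = 0 by rewrite -brmulnA divnK.
apply: (IH (n %/ pdiv n)) => //.
- by rewrite ltn_Pdiv // prime_gt1.
- by rewrite divn_gt0 ?pdiv_gt0 // dvdn_leq.
apply: (Z_tf _ (prime_gt0 pp) pa0).
by apply: (prime_order_center dedB nilB pp pa0); apply: star_muln.
Qed.

(** If z ≠ 0 then z has infinite order, λ_x(nx) = nz + nx, and 2x has self-star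
    4z. So 4z generates an ideal E, and E together with 2x generates an ideal S,
    which contains λ_x(2x) - 2x = 2z. Expressing 2z through 2x and 4z and applying
    λ_x shows that the coefficient of 2x vanishes; so 2z is a multiple of 4z,
    which is absurd. *)
Lemma star_self_central_eq0 x : center B (star x x) -> star x x = 0.
Proof.
move=> Zz; set z := star x x in Zz *.
have lz y : lambda y z = z by apply: center_lambda.
have zl y : lambda z y = y by case: Zz => -[zl _] _; exact: zl.
have zD y : z + y = y + z by case: Zz => -[_ zD] _; exact: zD.
have zz0 : star z z = 0 by apply/star0E.
apply: contrapT => z0.
have z_inf n : (0 < n)%N -> z *+ n <> 0 by move=> n0 /(Z_tf Zz n0).
have lxx : lambda x x = z + x by rewrite /z starE braddNK.
have lxX n : lambda x (x *+ n) = z *+ n + x *+ n.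
  by rewrite lambdaMn lxx; apply: (@expgMn (addg B)); apply: zD.
have xx : x ∘ x = z ∘ (x *+ 2).
  by rewrite !mulE zl lxx braddA -(zD x) -braddA.
have st2 : star (x *+ 2) (x *+ 2) = z *+ 4.
  rewrite starE -[X in X - _]zl -lambdaM -xx lambdaM lxX lambdaD lambdaMn lz lxX.
  by rewrite braddA -brmulnD braddK.
pose E := Ideal (dedB (sub_skew_brace_acyc (star_muln zz0 4))).
have E22 : ideal_set E (star (x *+ 2) (x *+ 2)).
  by rewrite st2; apply: (@mem_cyc (addg B)).
pose S := Ideal (is_ideal_adjoin dedB E22).
have Sz : ideal_set S (z *+ 2).
  have -> : z *+ 2 = lambda x (x *+ 2) - x *+ 2 by rewrite lxX braddK.
  have S2 : ideal_set S (x *+ 2) by apply: mem_adjoin.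
  have gS := ideal_add_subgroup (idealP S).
  apply: (group_closed_div gS) => //.
  exact: (ideal_lambda (idealP S)).
have [m [n zE]] := Sz; pose y := x *+ 2.
have /pi_quot_eq[k [l h]] : \pi_(quot E) (z *+ 2 + y *+ n) = \pi_(quot E) (y *+ m).
  rewrite pi_braddE zE !pi_muln; exact: (@mulgVK (addg (quot E))).
have {}h : y *+ m + z *+ (4 * l) = z *+ 2 + y *+ n + z *+ (4 * k).
  apply: (@braddI _ (- (z *+ 2 + y *+ n))).
  rewrite braddA h braddKr -!brmulnA.
  by rewrite -[LHS]/((_ - _) + _) !(@expgnA (addg B)) braddNK.
have zn (i : nat) (w : B) : z *+ i + w = w + z *+ i.
  apply/(@commute_sym (addg B))/(@commuteX (addg B)).
  exact/(@commute_sym (addg B))/zD.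
have lzn i : lambda x (z *+ i) = z *+ i by rewrite lambdaMn lz.
have lyn i : lambda x (y *+ i) = z *+ (2 * i) + y *+ i.
  by rewrite /y -!brmulnA lxX.
have mn : m = n.
  have := congr1 (fun w => lambda x w) h.
  rewrite !(lzn, lyn, lambdaD) -[LHS]braddA h [in RHS]braddA.
  rewrite (zn 2%N (z *+ (2 * n))) -!braddA => /braddIr.
  by move=> /(@exp_inj (addg B) _ _ _ z_inf)/eqP; rewrite eqn_mul2l => /eqP.
move: h; rewrite mn -zn -[RHS]braddA -(zn (4 * k)%N) braddA => /braddIr.
rewrite -brmulnD => /(@exp_inj (addg B) _ _ _ z_inf)/(congr1 (modn^~ 4)).
by rewrite modnMr addnC mulnC modnMDl.
Qed.

Lemma star_self_central_center x : center B (star x x) -> center B x.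
Proof.
move=> /star_self_central_eq0 xx0.
have [[n [n0 nx]]|x_inf] := pselect (exists n, (0 < n)%N /\ x *+ n = 0).
  by rewrite (finite_order_eq0 xx0 n0 nx); apply: center0.
by apply: infinite_order_center => // n n0 nx; apply: x_inf; exists n.
Qed.

Lemma all_center x : center B x.
Proof.
have [n] := nilB x; elim: n x => [|n IH] x; first by move=> /= ->; apply: center0.
by rewrite iterSr => /IH; apply: star_self_central_center.
Qed.

End Conclusion.

(** If [x] enters the series at a successor stage j of i, then its self-star lies
    in the i-th ideal, because the factor is trivial; at a limit stage [x] already
    lies in an earlier ideal. *)
Lemma trivial_series_star_nil (B : skewBraceType) : has_trivial_series B -> star_nil B.
Proof.
move=> [d [J [I [[[wf I0 Ile Ilim] Itop] triv]]]] x.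
have : ideal_set (I \top%O) x by rewrite Itop.
elim/(well_founded_ind wf): {x}(\top%O) (x) => j IH x Ijx.
have [j0|j_neq0] := eqVneq j \bot%O.
  by exists 0%N; move: Ijx; rewrite j0 I0.
have [[i ij]|nsucc] := pselect (exists i, succ_of i j).
  have Ii_xx : ideal_set (I i) (star x x).
    apply/pi_eq0; rewrite pi_star; apply/star0E.
    apply: (@braddI _ (\pi_(quot (I i)) x)); rewrite -mulE.
    by symmetry; apply: (triv i j ij); exists x.
  by have [n nE] := IH i ij.1 _ Ii_xx; exists n.+1; rewrite iterSr.
move: Ijx; rewrite Ilim; first by case=> i ij Iix; apply: (IH i).
by split=> // i ij; apply: nsucc; exists i.
Qed.

Lemma socle_trivial_on (B : skewBraceType) : trivial_on (socle B).
Proof. by move=> a b [la _] _; rewrite mulE la. Qed.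

Theorem corollary3p10 (B : skewBraceType) (dedB : dedekind B) :
  (hypermultipermutational B -> has_trivial_series B) /\
  (has_trivial_series B -> add_torsion_free (center B) -> trivial_brace B).
Proof.
split=> [[d [J [I [[chI socI] Itop]]]]|serB Z_tf a b].
  exists d, J, I; split=> // i j ij; rewrite socI //; exact: socle_trivial_on.
have [[la _] _] := all_center dedB (trivial_series_star_nil serB) Z_tf a.
by rewrite mulE la.
Qed.
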